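(* Let $f$ satisfy the Lipschitz condition with constant $0<L<\infty$ on $D=[a,b]\subset\mathbb{R}^n$, and let $\{y^k\}$ be the infinite sequence of trial points generated by the algorithm NDAL (with parameters $r>1$, $C>0$, $\xi>0$, with $\varepsilon=0$, and with either Bisection or Partition $2^n$ as the partition strategy) applied to minimizing $f$ over $D$. Let $x^*$ be a global minimizer of $f$ over $D$. Suppose there exists an iteration number $l^*$ such that for every $l>l^*$ there is a cell $D_j=[a_j,b_j]$, $j=j(l)$, of the partition current at iteration $l$, containing $x^*$ and satisfying $$K_j(l)\ \ge\ 2H_j,\qquad\text{where}\qquad H_j=\max\left\{\frac{f(a_j)-f(x^* )}{\|x^*-a_j\|},\ \frac{f(b_j)-f(x^* )}{\|b_j-x^*\|}\right\}.$$ Then $x^*$ is a limit point of the sequence $\{y^k\}$.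
   Context: **Problem.** $a,b\in\mathbb{R}^n$, $a\le b$ componentwise, $a\ne b$, and $D=[a,b]=\{x\in\mathbb{R}^n: a\le x\le b\}$. The function $f:D\to\mathbb{R}$ satisfies $|f(x')-f(x'')|\le L\|x'-x''\|$ for all $x',x''\in D$, with $0<L<\infty$, where $\|\cdot\|$ is the Euclidean norm. A global minimizer is a point $x^*\in D$ with $f(x^* )=\min_{x\in D}f(x)$. **Algorithm NDAL** (parameters $r>1$, $C>0$, $\xi>0$; infinite version $\varepsilon=0$, i.e. the algorithm is never stopped). After $l\ge1$ iterations $D$ is subdivided into $m(l)$ cells $D_i=[a_i,b_i]$ with $a_i\le b_i$ componentwise, $1\le i\le m(l)$; each cell carries a number $\lambda_i\ge 0$ fixed when the cell is created. ''Trial'' means evaluation of $f$ at a point; trial points are the points at which $f$ is evaluated, and $\{y^k\}$ lists them in the order of generation (points generated in the same iteration in any order). Initialization ($l=1$): $m(1)=1$, $D_1=[a,b]$, trials at $a$ and $b$, $\lambda_1=|f(a)-f(b)|/\|a-b\|$. Iteration $l+1$ ($l\ge1$): 1. Set $\mu=\max_{1\le i\le m(l)}\lambda_i$, $d^{\max}=\max_{1\le i\le m(l)}\|a_i-b_i\|$, and for each cell $D_i$ $$\gamma_i=\mu\,\frac{\|a_i-b_i\|}{d^{\max}},\qquad K_i=K_i(l)=\Big(r+\frac{C}{l}\Big)\max\{\lambda_i,\gamma_i,\xi\},$$ $$R_i=R_i(l)=\tfrac12\big(K_i\|a_i-b_i\|-f(a_i)-f(b_i)\big).$$ 2. Choose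 a cell $D_t$ with $R_t=\max_{1\le i\le m(l)}R_i$ (ties broken arbitrarily). 3. Set $\hat K=(4+\frac{C}{l})\max\{\mu,\xi\}$ and $$x^{l+1}=\frac{a_t+b_t}{2}-\frac{f(b_t)-f(a_t)}{2\hat K}\cdot\frac{b_t-a_t}{\|a_t-b_t\|},$$ a point on the main diagonal of $D_t$ (the segment joining $a_t$ and $b_t$). 4. Replace $D_t$ by $p$ new cells, using one strategy fixed throughout the run: - Bisection ($p=2$): $D_t$ is cut into two cells by the hyperplane through $x^{l+1}$ orthogonal to a longest edge of $D_t$; - Partition $2^n$ ($p=2^n$): $D_t$ is cut into $2^n$ cells by the $n$ hyperplanes through $x^{l+1}$ parallel to the boundary faces of $D_t$. 5. Evaluate $f$ at those vertices $a_j,b_j$ (lower and upper corners) of the new cells $D_j=[a_j,b_j]$ other than $a_t,b_t$ (these are the new trial points), and assign to every one of the $p$ new cells the same value $$\lambda=\max\Big\{\frac{|f(a_t)-f(b_t)|}{\|a_t-b_t\|},\ \max_{1\le j\le p}\frac{|f(a_j)-f(b_j)|}{\|a_j-b_j\|}\Big\}.$$ Then $m(l+1)=m(l)+p-1$; replace $l$ by $l+1$ and repeat. ''The partition current at iteration $l$'' means the cells $D_i$, $1\le i\le m(l)$, with the associated values $K_i(l)$. In $H_j$, a term whose denominator is zero (i.e. $x^*=a_j$ or $x^*=b_j$) is omitted from the maximum. A limit point of a sequence is a point that is the limit of some subsequence. *)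

(* Defs.v *)
From mathcomp Require Import all_boot all_order all_algebra.
From mathcomp Require Import all_classical all_reals all_analysis.

Set Implicit Arguments.
Unset Strict Implicit.
Unset Printing Implicit Defensive.

Import Order.TTheory GRing.Theory Num.Theory.
Import numFieldNormedType.Exports.

Local Open Scope classical_set_scope.
Local Open Scope ring_scope.

(* The norm that the library puts on 'rV[R]_n is the max norm, so the
   Euclidean norm is defined here. *)
Definition enorm (R : realType) (n : nat) (v : 'rV[R]_n) : R :=
  Num.sqrt (\sum_(i < n) v ord0 i ^+ 2).

Definition vle (R : realType) (n : nat) (u v : 'rV[R]_n) : Prop :=
  forall i : 'I_n, u ord0 i <= v ord0 i.

Definition in_box (R : realType) (n : nat) (a b x : 'rV[R]_n) : Prop :=
  vle a x /\ vle x b.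

Definition lipschitz_on_box (R : realType) (n : nat) (a b : 'rV[R]_n)
    (f : 'rV[R]_n -> R) (L : R) : Prop :=
  forall x x' : 'rV[R]_n, in_box a b x -> in_box a b x' ->
    `|f x - f x'| <= L * enorm (x - x').

Definition global_minimizer (R : realType) (n : nat) (a b : 'rV[R]_n)
    (f : 'rV[R]_n -> R) (xs : 'rV[R]_n) : Prop :=
  in_box a b xs /\ forall x : 'rV[R]_n, in_box a b x -> f xs <= f x.

(* Convergence in 'rV[R]_n is coordinatewise, i.e. convergence for [enorm]. *)
Definition subsequential_limit (R : realType) (n : nat) (y : nat -> 'rV[R]_n)
    (x : 'rV[R]_n) : Prop :=
  exists s : nat -> nat, increasing_seq s /\ (fun k => y (s k)) @ \oo --> x.

(* A corner pair (a_i, b_i) stands for the box [a_i, b_i]; a cell is a corner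
   pair together with the number lambda_i. *)
Notation corners R n := ('rV[R]_n * 'rV[R]_n)%type.
Notation cell R n := (corners R n * R)%type.

Section Algorithm.
Context (R : realType) (n : nat).
Implicit Types (B : corners R n) (D : cell R n) (P : seq (cell R n)).

Definition diag B : R := enorm (B.1 - B.2).

Definition lo D : 'rV[R]_n := D.1.1.
Definition hi D : 'rV[R]_n := D.1.2.
Definition lam D : R := D.2.

Variables (f : 'rV[R]_n -> R) (r C xi : R).

Definition slope B : R := `|f B.1 - f B.2| / diag B.

(* The neutral element 0 is harmless: the maxima below are over nonempty lists
   of nonnegative numbers. *)
Definition mu P : R := \big[Num.max/0]_(D <- P) lam D.
Definition dmax P : R := \big[Num.max/0]_(D <- P) diag D.1.

Definition gamma P D : R := mu P * (diag D.1 / dmax P).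

Definition K (l : nat) P D : R :=
  (r + C / l%:R) * Num.max (lam D) (Num.max (gamma P D) xi).

Definition characteristic (l : nat) P D : R :=
  2^-1 * (K l P D * diag D.1 - f (lo D) - f (hi D)).

Definition Khat (l : nat) P : R := (4 + C / l%:R) * Num.max (mu P) xi.

Definition new_point (l : nat) P B : 'rV[R]_n :=
  2^-1 *: (B.1 + B.2)
  - ((f B.2 - f B.1) / (2 * Khat l P)) *: ((diag B)^-1 *: (B.2 - B.1)).

Inductive strategy : Set := Bisection | Partition2n.

Definition splice (J : {set 'I_n}) (u v : 'rV[R]_n) : 'rV[R]_n :=
  \row_k (if k \in J then u ord0 k else v ord0 k).

Definition longest_edge B (i : 'I_n) : Prop :=
  forall k : 'I_n, B.2 ord0 k - B.1 ord0 k <= B.2 ord0 i - B.1 ord0 i.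

(* In the 2^n case the subcell indexed by J lies on the upper side of the k-th
   hyperplane exactly when k \in J; a box with edges of zero length still
   gives 2^n subcells, some of them equal. *)
Definition cut (st : strategy) (x : 'rV[R]_n) B (new : seq (corners R n)) :
    Prop :=
  match st with
  | Bisection => exists2 i : 'I_n, longest_edge B i &
      new = [:: (B.1, splice [set i]%SET x B.2); (splice [set i]%SET x B.1, B.2)]
  | Partition2n =>
      new = [seq (splice J x B.1, splice J B.2 x) | J <- enum {: {set 'I_n}}]
  end.

Definition new_lam B (new : seq (corners R n)) : R :=
  \big[Num.max/slope B]_(B' <- new) slope B'.

Definition new_trials B (new : seq (corners R n)) : seq 'rV[R]_n :=
  undup [seq v <- flatten [seq [:: B'.1; B'.2] | B' <- new]
        | v \notin [:: B.1; B.2]].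

(* [P] is the current list of cells and [Y] the list of trial points after
   iteration [l]; [P'] and [Y'] are the same after iteration [l.+1].  Lists of
   cells are compared up to order, and so are the trial points that one
   iteration adds. *)
Definition ndal_step (st : strategy) (l : nat) P P' (Y Y' : seq 'rV[R]_n) :
    Prop :=
  exists (Dt : cell R n) (new : seq (corners R n)) (Z : seq 'rV[R]_n),
    [/\ Dt \in P /\
          (forall D, D \in P -> characteristic l P D <= characteristic l P Dt),
        cut st (new_point l P Dt.1) Dt.1 new,
        perm_eq P' ([seq (B, new_lam Dt.1 new) | B <- new] ++ rem Dt P),
        perm_eq Z (new_trials Dt.1 new)
      & Y' = Y ++ Z].

(* An infinite run: [P l] lists the cells after [l] iterations ([l >= 1], the
   value at 0 is irrelevant) and [y 0, y 1, ...] are the trial points in order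
   of generation, [N l] of which are generated in the first [l] iterations. *)
Definition ndal_run (st : strategy) (a b : 'rV[R]_n) (P : nat -> seq (cell R n))
    (N : nat -> nat) (y : nat -> 'rV[R]_n) : Prop :=
  [/\ P 1%N = [:: ((a, b), slope (a, b))],
      perm_eq (mkseq y (N 1%N)) [:: a; b]
    & forall l : nat, (1 <= l)%N ->
        ndal_step st l (P l) (P l.+1) (mkseq y (N l)) (mkseq y (N l.+1))].

(* The quantity H_j; a term whose denominator vanishes is omitted. *)
Definition H (xs : 'rV[R]_n) D : R :=
  let Ha := (f (lo D) - f xs) / enorm (xs - lo D) in
  let Hb := (f (hi D) - f xs) / enorm (hi D - xs) in
  if xs == lo D then Hb else if xs == hi D then Ha else Num.max Ha Hb.

End Algorithm.

(* Main.v *)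
(* The cell D of xs satisfies ||xs - a_D|| + ||b_D - xs|| <= 3/2 d(D), since
   xs - a_D and b_D - xs form a nonnegative scalar product; with K_D >= 2 H_D
   this gives R_D >= K_D d(D) / 8 - f(xs), while every cell has
   R <= K d / 2 - f(xs) with K bounded.  As R_t >= R_D, the diagonal of D is at
   most a constant times that of the cell selected for splitting.  Now
   K^ >= 4 mu puts the cutting point in the middle quarter of the diagonal, so
   a child's diagonal is at most sqrt q times its parent's, q < 1 depending
   only on n; for M large the sum of d^(2M) over the partition drops by at least
   d_t^(2M) / 2 at each step, hence cells with arbitrarily small diagonal are
   selected arbitrarily late.  The two corners of D are distinct trial points
   within d(D) of xs, so one of them differs from xs. *)
Require Import Defs.
From mathcomp Require Import all_boot all_order all_algebra.
From mathcomp Require Import all_classical all_reals all_analysis.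
From mathcomp Require Import ring lra.
Import Order.TTheory GRing.Theory Num.Theory.
Import numFieldNormedType.Exports.
Local Open Scope ring_scope.

(** * Euclidean norm and diagonals of boxes *)

Lemma enorm_ge0 {R : realType} {n : nat} (v : 'rV[R]_n) : 0 <= enorm v.
Proof. exact: sqrtr_ge0. Qed.

Lemma enorm_sqr {R : realType} {n : nat} (v : 'rV[R]_n) :
  enorm v ^+ 2 = \sum_(i < n) v ord0 i ^+ 2.
Proof. by rewrite sqr_sqrtr // sumr_ge0 // => i _; exact: sqr_ge0. Qed.

Lemma le_enorm {R : realType} {n : nat} (u v : 'rV[R]_n) :
  (forall i, u ord0 i ^+ 2 <= v ord0 i ^+ 2) -> enorm u <= enorm v.
Proof. by move=> uv; apply: ler_wsqrtr; apply: ler_sum => i _; exact: uv. Qed.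

Lemma coord_le_enorm {R : realType} {n : nat} (v : 'rV[R]_n) (i : 'I_n) :
  `|v ord0 i| <= enorm v.
Proof.
rewrite -(@ler_pXn2r _ 2) ?nnegrE ?enorm_ge0 // enorm_sqr real_normK ?num_real//.
rewrite (bigD1 i) //= lerDl sumr_ge0 // => j _; exact: sqr_ge0.
Qed.

Lemma enorm0 {R : realType} {n : nat} : enorm (0 : 'rV[R]_n) = 0.
Proof. by rewrite /enorm big1 ?sqrtr0 // => i _; rewrite mxE expr0n. Qed.

Lemma enorm_gt0 {R : realType} {n : nat} (v : 'rV[R]_n) :
  (0 < enorm v) = (v != 0).
Proof.
rewrite lt_neqAle enorm_ge0 andbT eq_sym; congr (~~ _); apply/eqP/eqP => [v0|->].
  apply/rowP => i; rewrite mxE; apply/eqP; rewrite -normr_le0 -v0.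
  exact: coord_le_enorm.
exact: enorm0.
Qed.

Lemma diag_sqr {R : realType} {n : nat} (B : corners R n) :
  diag B ^+ 2 = \sum_(i < n) (B.2 ord0 i - B.1 ord0 i) ^+ 2.
Proof. by rewrite enorm_sqr; apply: eq_bigr => i _; rewrite !mxE -sqrrN opprB. Qed.

Lemma diag_gt0 {R : realType} {n : nat} (B : corners R n) :
  (0 < diag B) = (B.1 != B.2).
Proof. by rewrite enorm_gt0 subr_eq0. Qed.

(* [ (x - u) . (v - x) >= 0 ] for a point of the box, so the two distances to
   the corners are at most the legs of a right triangle with hypotenuse
   [diag (u, v)]; 3/2 bounds [sqrt 2]. *)
Lemma enorm_corners_le {R : realType} {n : nat} (u v x : 'rV[R]_n) :
  in_box u v x -> enorm (x - u) + enorm (v - x) <= 3 / 2 * diag (u, v).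
Proof.
move=> [ux xv].
have leg : enorm (x - u) ^+ 2 + enorm (v - x) ^+ 2 <= diag (u, v) ^+ 2.
  rewrite diag_sqr !enorm_sqr -big_split /=; apply: ler_sum => i _.
  rewrite !mxE /=.
  have := mulr_ge0 (_ : 0 <= x ord0 i - u ord0 i) (_ : 0 <= v ord0 i - x ord0 i).
  by rewrite !subr_ge0 => /(_ (ux i) (xv i)); nra.
have := enorm_ge0 (x - u); have := enorm_ge0 (v - x).
have : 0 <= diag (u, v) by exact: enorm_ge0.
move: leg; move: (enorm _) (enorm _) (diag _) => p q d leg d0 q0 p0.
rewrite -(@ler_pXn2r _ 2) ?nnegrE ?addr_ge0 ?mulr_ge0 //.
by have := sqr_ge0 (p - q); nra.
Qed.

(** * Contraction of the diagonal under a cut *)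

(* A cut leaves at most 5/8 of the longest edge, whose square is at least
   [diag ^+ 2 / n], and 1 - (5/8)^2 = 39/64. *)
Definition shrink {R : realType} (n : nat) : R := 1 - 39 / (64 * n%:R).

Lemma shrink_itv {R : realType} (n : nat) : (0 < n)%N ->
  25 / 64 <= (shrink n : R) < 1.
Proof.
move=> n0; rewrite /shrink.
have n1 : 1 <= n%:R :> R by rewrite ler1n.
have -> : 39 / (64 * n%:R) = 39 / 64 * n%:R^-1 :> R by rewrite invfM mulrA.
have : 0 < n%:R^-1 :> R by rewrite invr_gt0 (lt_le_trans _ n1).
have : n%:R^-1 <= 1 :> R by rewrite invf_le1 // (lt_le_trans _ n1).
by lra.
Qed.

Lemma longest_edge_ge {R : realType} {n : nat} (B : corners R n) (i : 'I_n) :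
  vle B.1 B.2 -> longest_edge B i ->
  diag B ^+ 2 <= n%:R * (B.2 ord0 i - B.1 ord0 i) ^+ 2.
Proof.
move=> B12 Bi; rewrite diag_sqr.
rewrite mulrC -[X in _ * X%:R](card_ord n) mulr_natr -sumr_const.
apply: ler_sum => k _.
rewrite ler_pXn2r ?nnegrE ?subr_ge0 //; by [exact: Bi | exact: B12].
Qed.

(** Distinct corners keep every later slope a genuine quotient; squared diagonals avoid square
    roots. *)
Definition subcell {R : realType} {n : nat} (B B' : corners R n) : Prop :=
  [/\ vle B.1 B'.1, vle B'.1 B'.2, vle B'.2 B.2, B'.1 != B'.2
    & diag B' ^+ 2 <= shrink n * diag B ^+ 2].

(** Edges other than [i] do not grow, by containment; edge [i] loses at least 39/64 of its square,
    which is at least [diag B ^+ 2 / n]. *)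
Lemma subcell_bisection {R : realType} {n : nat} (B B' : corners R n)
    (i : 'I_n) (t : R) :
  vle B.1 B.2 -> B.1 != B.2 -> longest_edge B i -> 0 < t <= 5 / 8 ->
  vle B.1 B'.1 -> vle B'.1 B'.2 -> vle B'.2 B.2 ->
  B'.2 ord0 i - B'.1 ord0 i = t * (B.2 ord0 i - B.1 ord0 i) ->
  subcell B B'.
Proof.
move=> B12 Bd Bi /andP[t0 t58] B1 B'12 B2 Ei.
have n0 : (0 < n)%N by apply: leq_ltn_trans (ltn_ord i).
have n0R : 0 < n%:R :> R by rewrite ltr0n.
have long := longest_edge_ge B i B12 Bi.
have d0 : 0 < diag B by rewrite diag_gt0.
set e := B.2 ord0 i - B.1 ord0 i in Ei long.
have e0 : 0 < e.
  rewrite lt_neqAle subr_ge0 B12 andbT; apply/eqP => e0.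
  by move: long; rewrite -e0 expr0n mulr0 leNgt exprn_gt0.
split=> //.
  apply/eqP => B'0; have : 0 < t * e by rewrite mulr_gt0.
  by rewrite -Ei B'0 subrr ltxx.
have -> : shrink n * diag B ^+ 2 = diag B ^+ 2 - 39 / 64 * (diag B ^+ 2 / n%:R).
  by rewrite /shrink; field; rewrite lt0r_neq0.
have : diag B ^+ 2 / n%:R <= e ^+ 2 by rewrite ler_pdivrMr // mulrC.
have : diag B' ^+ 2 <= diag B ^+ 2 - 39 / 64 * e ^+ 2; last by lra.
rewrite !diag_sqr (bigD1 i) //= [X in _ <= X - _](bigD1 i) //= -/e Ei.
have : \sum_(j < n | j != i) (B'.2 ord0 j - B'.1 ord0 j) ^+ 2 <=
       \sum_(j < n | j != i) (B.2 ord0 j - B.1 ord0 j) ^+ 2.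
  apply: ler_sum => j _; have := B1 j; have := B'12 j; have := B2 j; nra.
have : (t * e) ^+ 2 <= 25 / 64 * e ^+ 2.
  rewrite exprMn ler_wpM2r ?sqr_ge0 //; nra.
by lra.
Qed.

(** Every edge shrinks, so the squared diagonal falls to at most 25/64 of its value, below
    [shrink n]. The ratio depends on the edge because each subcell picks a side of each
    hyperplane. *)
Lemma subcell_partition {R : realType} {n : nat} (B B' : corners R n)
    (t : 'I_n -> R) :
  vle B.1 B.2 -> B.1 != B.2 -> (forall i, 0 < t i <= 5 / 8) ->
  vle B.1 B'.1 -> vle B'.2 B.2 ->
  (forall i, B'.2 ord0 i - B'.1 ord0 i = t i * (B.2 ord0 i - B.1 ord0 i)) ->
  subcell B B'.
Proof.
move=> B12 Bd tP B1 B2 E.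
have [i Bi] : exists i, B.1 ord0 i != B.2 ord0 i.
  apply/existsP; apply: contraR Bd; rewrite negb_exists => /forallP Beq.
  by apply/eqP/rowP => i; apply/eqP; have := Beq i; rewrite negbK.
have n0 : (0 < n)%N by apply: leq_ltn_trans (ltn_ord i).
split=> //.
- move=> j; rewrite -subr_ge0 E mulr_ge0 ?subr_ge0 //.
  by have /andP[/ltW] := tP j.
- apply/eqP => B'12; move: (E i); rewrite B'12 subrr => /esym/eqP.
  by rewrite mulf_eq0 subr_eq0 [_ == B.1 _ _]eq_sym (negbTE Bi) gt_eqF ?orbF //;
     have /andP[] := tP i.
have /andP[q1 _] := shrink_itv (R := R) n n0.
apply: (@le_trans _ _ (25 / 64 * diag B ^+ 2)); last first.
  by rewrite ler_wpM2r // sqr_ge0.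
rewrite !diag_sqr mulr_sumr; apply: ler_sum => j _.
rewrite E exprMn ler_wpM2r ?sqr_ge0 //.
by have /andP[] := tP j; nra.
Qed.

(** The bound [(2 ^ n).+1] serves both strategies: it dominates 2 as well as [2 ^ n]. *)
Lemma cut_subcell {R : realType} {n : nat} (st : strategy) (B : corners R n)
    (x : 'rV[R]_n) (t : R) (new : seq (corners R n)) :
  vle B.1 B.2 -> B.1 != B.2 -> 3 / 8 <= t <= 5 / 8 ->
  (forall i, x ord0 i = B.1 ord0 i + t * (B.2 ord0 i - B.1 ord0 i)) ->
  Defs.cut st x B new ->
  (forall B', B' \in new -> subcell B B') /\ (size new <= (2 ^ n).+1)%N.
Proof.
move=> B12 Bd /andP[t38 t58] xE.
have xB i : B.1 ord0 i <= x ord0 i <= B.2 ord0 i.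
  by rewrite xE; have := B12 i; nra.
case: st => /=.
  move=> [i Bi ->]; split=> [B'|/=]; last first.
    by rewrite ltnS expn_gt0.
  rewrite !inE => /orP[] /eqP -> /=.
    apply: (@subcell_bisection _ _ _ _ i t) => //=; first by lra.
    - by move=> k; rewrite mxE; case: ifP => // _; case/andP: (xB k).
    - by move=> k; rewrite mxE; case: ifP => // _; case/andP: (xB k).
    - by rewrite mxE inE eqxx xE; ring.
  apply: (@subcell_bisection _ _ _ _ i (1 - t)) => //=; first by lra.
  - by move=> k; rewrite mxE; case: ifP => // _; case/andP: (xB k).
  - by move=> k; rewrite mxE; case: ifP => // _; case/andP: (xB k).
  - by rewrite mxE inE eqxx xE; ring.
move=> ->; split; last first.
  by rewrite size_map -cardE -cardsT -powersetT card_powerset cardsT card_ord.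
move=> _ /mapP[J _ ->].
apply: (@subcell_partition _ _ _ _ (fun i => if i \in J then 1 - t else t)) => //=.
- by move=> i; case: ifP => _; lra.
- by move=> k; rewrite mxE; case: ifP => // _; case/andP: (xB k).
- by move=> k; rewrite mxE; case: ifP => // _; case/andP: (xB k).
- by move=> i; rewrite !mxE; case: ifP => _; rewrite xE; ring.
Qed.

(** Relative to the diagonal, the offset from the midpoint has size [slope f B / (2 * Khat)], at
    most 1/8 since [Khat] is at least [4 * mu P]. Positivity of [xi] keeps [Khat] nonzero even when
    [mu P] is 0. *)
Lemma new_point_diagonal {R : realType} {n : nat} (f : 'rV[R]_n -> R)
    (C xi : R) (l : nat) (P : seq (cell R n)) (B : corners R n) :
  0 < C -> 0 < xi -> B.1 != B.2 -> slope f B <= mu P ->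
  exists2 t : R, 3 / 8 <= t <= 5 / 8
    & forall i, new_point f C xi l P B ord0 i
                = B.1 ord0 i + t * (B.2 ord0 i - B.1 ord0 i).
Proof.
move=> C0 xi0 Bd slB.
set Kh := Khat C xi l P.
have Cl : 0 <= C / l%:R by rewrite divr_ge0 // ltW.
have Kh_mu : 4 * mu P <= Kh.
  apply: ler_pM => //; first by rewrite /mu bigmax_ge_id.
    by rewrite lerDl.
  by rewrite le_max lexx.
have Kh0 : 0 < Kh.
  by rewrite mulr_gt0 ?ltr_wpDr // lt_max xi0 orbT.
have d0 : 0 < diag B by rewrite diag_gt0.
exists (2^-1 - (f B.2 - f B.1) / (2 * Kh) / diag B); last first.
  move=> i; rewrite !mxE -/Kh.
  by field; rewrite !lt0r_neq0.
have : `|(f B.2 - f B.1) / (2 * Kh) / diag B| <= 1 / 8.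
  have -> : (f B.2 - f B.1) / (2 * Kh) / diag B =
            (f B.2 - f B.1) / diag B / (2 * Kh) by rewrite mulrAC.
  have Kh2 : 0 < 2 * Kh by rewrite mulr_gt0.
  rewrite normf_div normf_div (gtr0_norm Kh2) (gtr0_norm d0) distrC -/(slope f B).
  by rewrite ler_pdivrMr //; lra.
by rewrite ler_norml; lra.
Qed.

(** * Invariant of the cells along a run *)

(** The lower bound on [lam] keeps cuts near the middle, the upper bound controls [K], and the
    corners supply trial points near the minimizer. *)
Definition valid_cell {R : realType} {n : nat} (a b : 'rV[R]_n)
    (f : 'rV[R]_n -> R) (L : R) (Y : seq 'rV[R]_n) (D : cell R n) : Prop :=
  [/\ vle a (lo D), vle (lo D) (hi D) & vle (hi D) b] /\
  [/\ lo D != hi D, slope f D.1 <= lam D <= L, lo D \in Y & hi D \in Y].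

Definition potential {R : realType} {n : nat} (M : nat) (P : seq (cell R n)) : R :=
  \sum_(D <- P) (diag D.1 ^+ 2) ^+ M.

Lemma vle_trans {R : realType} {n : nat} (v u w : 'rV[R]_n) :
  vle u v -> vle v w -> vle u w.
Proof. by move=> uv vw i; exact: le_trans (uv i) (vw i). Qed.

Lemma slope_le {R : realType} {n : nat} (a b : 'rV[R]_n)
    (f : 'rV[R]_n -> R) (L : R) (B : corners R n) :
  lipschitz_on_box a b f L -> B.1 != B.2 ->
  vle a B.1 -> vle B.1 B.2 -> vle B.2 b -> slope f B <= L.
Proof.
move=> fL Bd aB B12 Bb; rewrite ler_pdivrMr ?diag_gt0 //; apply: fL; split=> //.
  exact: vle_trans Bb.
exact: vle_trans B12.
Qed.

Lemma slope_ge0 {R : realType} {n : nat} (f : 'rV[R]_n -> R) (B : corners R n) :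
  0 <= slope f B.
Proof. by rewrite divr_ge0 ?enorm_ge0. Qed.

Lemma lam_le_mu {R : realType} {n : nat} (P : seq (cell R n)) (D : cell R n) :
  D \in P -> lam D <= mu P.
Proof. by move=> DP; exact: le_bigmax_seq. Qed.

Lemma initial_cell_valid {R : realType} {n : nat} (a b : 'rV[R]_n)
    (f : 'rV[R]_n -> R) (L : R) (Y : seq 'rV[R]_n) :
  vle a b -> a != b -> lipschitz_on_box a b f L -> a \in Y -> b \in Y ->
  valid_cell a b f L Y ((a, b), slope f (a, b)).
Proof.
move=> ab ad fL aY bY; split; split=> //.
by rewrite lexx (slope_le a b).
Qed.

(** [new_trials] leaves out the corners of the split cell, but these are already in [Y]. *)
Lemma mem_new_trials {R : realType} {n : nat} (B B' : corners R n)
    (new : seq (corners R n)) (Y Z : seq 'rV[R]_n) (v : 'rV[R]_n) :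
  B.1 \in Y -> B.2 \in Y -> perm_eq Z (new_trials B new) -> B' \in new ->
  v \in [:: B'.1; B'.2] -> v \in Y ++ Z.
Proof.
move=> B1Y B2Y ZE newB' vB'; rewrite mem_cat (perm_mem ZE) mem_undup mem_filter.
have [|_] := boolP (v \in [:: B.1; B.2]).
  by rewrite !inE => /orP[]/eqP ->; rewrite ?B1Y ?B2Y.
by rewrite andTb (_ : v \in flatten _) ?orbT //; apply/flatten_mapP; exists B'.
Qed.

(** [new_lam] is a maximum of slopes over boxes inside [[a, b]], the new cell's own included; this
    gives both bounds on [lam]. *)
Lemma ndal_step_valid {R : realType} {n : nat} (a b : 'rV[R]_n)
    (f : 'rV[R]_n -> R) (L r C xi : R) (st : strategy) (l : nat)
    (P P' : seq (cell R n)) (Y Y' : seq 'rV[R]_n) :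
  0 < C -> 0 < xi -> lipschitz_on_box a b f L ->
  (forall D, D \in P -> valid_cell a b f L Y D) ->
  ndal_step f r C xi st l P P' Y Y' ->
  forall D, D \in P' -> valid_cell a b f L Y' D.
Proof.
move=> C0 xi0 fL Pv [Dt [new [Z [[DtP _] cutE P'E ZE ->]]]] D.
have [[aDt Dt12 Dtb] [Dtd /andP[slDt lamDt] lDt hDt]] := Pv _ DtP.
have [t t38 tE] := new_point_diagonal f C xi l P Dt.1 C0 xi0 Dtd
  (le_trans slDt (lam_le_mu _ _ DtP)).
have [sub _] := cut_subcell st Dt.1 _ t new Dt12 Dtd t38 tE cutE.
rewrite (perm_mem P'E) mem_cat => /orP[/mapP[B newB ->]|/mem_rem DP]; last first.
  have [? [? ? lY hY]] := Pv _ DP.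
  by split=> //; split; rewrite // mem_cat ?lY ?hY.
have slL B' : B' \in new -> slope f B' <= L.
  move=> /sub [B'1 B'12 B'2 B'd _].
  by apply: (slope_le a b) => //; [exact: vle_trans B'1|exact: vle_trans Dtb].
have [B1 B12 B2 Bd _] := sub _ newB.
split; split=> //.
- exact: vle_trans B1.
- exact: vle_trans Dtb.
- rewrite /lam /= /new_lam le_bigmax_seq //= big_seq bigmax_le //.
  exact: le_trans lamDt.
- by apply: (mem_new_trials Dt.1 B new) => //; rewrite !inE eqxx.
- by apply: (mem_new_trials Dt.1 B new) => //; rewrite !inE eqxx orbT.
Qed.

(** * Decrease of the potential and late small splits *)

Lemma exists_shrink_exponent {R : realType} (n : nat) : (0 < n)%N ->
  exists M : nat, (2 ^ n).+1%:R * shrink n ^+ M <= 2^-1 :> R.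
Proof.
move=> n0; have /andP[q0 q1] := shrink_itv (R := R) n n0.
have qn : `|shrink n : R| < 1 by rewrite ger0_norm //; lra.
have /cvgrPdist_lt /(_ 2^-1) := cvg_geometric (2 ^ n).+1%:R qn.
rewrite invr_gt0 => /(_ (ltr0n _ 2)) [M _ /(_ M (leqnn M))] /=.
by rewrite sub0r normrN => /(le_lt_trans (ler_norm _)) /ltW ?; exists M.
Qed.

(** Each child contributes at most [shrink n ^+ M] times its parent's term, so by the choice of [M]
    all children together contribute at most half of it. *)
Lemma potential_step {R : realType} {n : nat} (a b : 'rV[R]_n)
    (f : 'rV[R]_n -> R) (L r C xi : R) (st : strategy) (l : nat) (M : nat)
    (P P' : seq (cell R n)) (Y Y' : seq 'rV[R]_n) :
  0 < C -> 0 < xi ->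
  (2 ^ n).+1%:R * shrink n ^+ M <= 2^-1 :> R -> (0 < n)%N ->
  (forall D, D \in P -> valid_cell a b f L Y D) ->
  ndal_step f r C xi st l P P' Y Y' ->
  exists Dt, [/\ Dt \in P,
    forall D, D \in P ->
      characteristic f r C xi l P D <= characteristic f r C xi l P Dt
    & potential M P' <= potential M P - 2^-1 * (diag Dt.1 ^+ 2) ^+ M].
Proof.
move=> C0 xi0 qM n0 Pv [Dt [new [Z [[DtP Dtmax] cutE P'E _ _]]]].
exists Dt; split=> //.
have [[aDt Dt12 Dtb] [Dtd /andP[slDt lamDt] _ _]] := Pv _ DtP.
have [t t38 tE] := new_point_diagonal f C xi l P Dt.1 C0 xi0 Dtd
  (le_trans slDt (lam_le_mu _ _ DtP)).
have [sub szn] := cut_subcell st Dt.1 _ t new Dt12 Dtd t38 tE cutE.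
have /andP[q0 _] := shrink_itv (R := R) n n0.
rewrite /potential (perm_big _ P'E) big_cat /= big_map /=.
rewrite (perm_big _ (perm_to_rem DtP)) big_cons /=.
set g := (diag Dt.1 ^+ 2) ^+ M.
have g0 : 0 <= g by rewrite exprn_ge0 // sqr_ge0.
suff : \sum_(B <- new) (diag B ^+ 2) ^+ M <= 2^-1 * g.
  by move: (\sum_(B <- new) _) (\sum_(D <- rem _ _) _) => s1 s2; lra.
apply: (@le_trans _ _ (\sum_(B <- new) (shrink n ^+ M * g))).
  rewrite big_seq [leRHS]big_seq; apply: ler_sum => B /sub [_ _ _ _ Bq].
  rewrite -exprMn; apply: lerXn2r; rewrite ?nnegrE ?sqr_ge0 //.
  by rewrite mulr_ge0 ?sqr_ge0 //; lra.
rewrite big_const_seq count_predT iter_addr_0 -[leLHS]mulr_natl mulrA.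
rewrite ler_wpM2r //; apply: le_trans qM.
by rewrite ler_wpM2r ?ler_nat // exprn_ge0 //; lra.
Qed.

Lemma ndal_run_valid {R : realType} {n : nat} (a b : 'rV[R]_n)
    (f : 'rV[R]_n -> R) (L r C xi : R) (st : strategy)
    (P : nat -> seq (cell R n)) (N : nat -> nat) (y : nat -> 'rV[R]_n) :
  0 < C -> 0 < xi -> vle a b -> a != b -> lipschitz_on_box a b f L ->
  ndal_run f r C xi st a b P N y ->
  forall l D, D \in P l.+1 -> valid_cell a b f L (mkseq y (N l.+1)) D.
Proof.
move=> C0 xi0 ab ad fL [P1 y1 step]; elim=> [D|l IH].
  rewrite P1 inE => /eqP ->.
  by apply: initial_cell_valid => //; rewrite (perm_mem y1) !inE eqxx ?orbT.
exact: ndal_step_valid (step l.+1 isT).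
Qed.

(** Otherwise every split after [l0] would lower the potential by at least a fixed [c > 0], making
    it negative eventually. *)
Lemma late_small_split {R : realType} {n : nat} (a b : 'rV[R]_n)
    (f : 'rV[R]_n -> R) (L r C xi : R) (st : strategy)
    (P : nat -> seq (cell R n)) (N : nat -> nat) (y : nat -> 'rV[R]_n)
    (l0 : nat) (e : R) :
  0 < C -> 0 < xi -> vle a b -> a != b -> lipschitz_on_box a b f L ->
  ndal_run f r C xi st a b P N y -> 0 < e ->
  exists l Dt, [/\ (l0 < l)%N, Dt \in P l,
    forall D, D \in P l ->
      characteristic f r C xi l (P l) D <= characteristic f r C xi l (P l) Dt
    & diag Dt.1 < e].
Proof.
move=> C0 xi0 ab ad fL run e0.
have n0 : (0 < n)%N.
  (* In dimension 0 all row vectors coincide, contradicting [a != b]. *)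
  by case: n a b ad {ab fL f P y run} => // a b; rewrite thinmx0 [b]thinmx0 eqxx.
have [M qM] := exists_shrink_exponent (R := R) n n0.
apply: contrapT => noSmall.
set c := 2^-1 * (e ^+ 2) ^+ M.
have c0 : 0 < c by rewrite mulr_gt0 ?invr_gt0 ?exprn_gt0.
have decr k : potential M (P (l0.+1 + k)%N) <= potential M (P l0.+1) - c * k%:R.
  elim: k => [|k IH]; first by rewrite addn0 mulr0 subr0.
  have [_ _ /(_ (l0 + k).+1 isT) step] := run.
  have [Dt [DtP Dtmax drop]] := potential_step a b f L r C xi st _ M _ _ _ _ C0 xi0
    qM n0 (ndal_run_valid a b f L r C xi st P N y C0 xi0 ab ad fL run _) step.
  have ge_e : e <= diag Dt.1.
    rewrite leNgt; apply/negP => small; apply: noSmall.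
    by exists (l0 + k).+1, Dt; split=> //; rewrite ltnS leq_addr.
  have : c <= 2^-1 * (diag Dt.1 ^+ 2) ^+ M.
    rewrite ler_wpM2l ?invr_ge0 // -!exprM lerXn2r ?nnegrE ?enorm_ge0 //.
    exact: ltW.
  rewrite -(natr1 k) addnS; move: drop IH; rewrite !addSn; lra.
have pot0 l : 0 <= potential M (P l).
  by rewrite sumr_ge0 // => D _; rewrite exprn_ge0 // sqr_ge0.
have := truncnS_gt (potential M (P l0.+1) / c).
set k := (Num.Def.trunc _).+1; rewrite ltr_pdivrMr //.
by have := decr k; have := pot0 (l0.+1 + k)%N; lra.
Qed.

(** * Bounds on [K] and on the characteristics *)

Lemma K_ge {R : realType} {n : nat} (r C xi : R) (l : nat)
    (P : seq (cell R n)) (D : cell R n) :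
  1 < r -> 0 < C -> 0 < xi -> xi <= K r C xi l P D.
Proof.
move=> r1 C0 xi0; rewrite -[leLHS]mul1r; apply: ler_pM => //; first exact: ltW.
  by have : 0 <= C / l%:R; [rewrite divr_ge0 // ltW | lra].
by rewrite !le_max lexx !orbT.
Qed.

(** [C / l] is at most [C], and [gamma] is at most [mu P], hence at most [L], because
    [diag D.1 / dmax P] is at most 1. *)
Lemma K_le {R : realType} {n : nat} (a b : 'rV[R]_n) (f : 'rV[R]_n -> R)
    (L r C xi : R) (l : nat) (P : seq (cell R n)) (Y : seq 'rV[R]_n)
    (D : cell R n) :
  0 < L -> 1 < r -> 0 < C -> 0 < xi -> (0 < l)%N ->
  (forall D', D' \in P -> valid_cell a b f L Y D') -> D \in P ->
  K r C xi l P D <= (r + C) * Num.max L xi.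
Proof.
move=> L0 r1 C0 xi0 l0 Pv DP.
have l1 : 1 <= l%:R :> R by rewrite ler1n.
have Cl : C / l%:R <= C.
  by rewrite ler_pdivrMr ?(lt_le_trans _ l1) // ler_peMr // ltW.
have Cl0 : 0 <= C / l%:R by rewrite divr_ge0 // ltW.
have muL : mu P <= L.
  rewrite /mu big_seq bigmax_le //; first exact: ltW.
  by move=> D' /Pv [_ [_ /andP[]]].
have gL : gamma P D <= L.
  apply: le_trans muL; have [_ [Dd _ _ _]] := Pv _ DP.
  have dD : diag D.1 <= dmax P.
    exact: (le_bigmax_seq 0 D xpredT (fun D0 => diag D0.1)).
  have dm0 : 0 < dmax P by apply: lt_le_trans dD; rewrite diag_gt0.
  by rewrite ler_piMr ?ler_pdivrMr ?mul1r // bigmax_ge_id.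
have lamL : lam D <= L by rewrite (le_trans (lam_le_mu _ _ DP)).
apply: ler_pM; rewrite ?lerD2l //.
- by rewrite addr_ge0 // ltW // (lt_trans _ r1).
- by rewrite !le_max (ltW xi0) !orbT.
- by rewrite !ge_max !le_max lamL gL lexx !orbT.
Qed.

Lemma characteristic_le {R : realType} {n : nat} (f : 'rV[R]_n -> R)
    (r C xi : R) (l : nat) (P : seq (cell R n)) (D : cell R n) (m : R) :
  m <= f (lo D) -> m <= f (hi D) ->
  characteristic f r C xi l P D <= 2^-1 * K r C xi l P D * diag D.1 - m.
Proof. by rewrite /characteristic => *; lra. Qed.

(** The excesses of [f] at the two corners over [f xs] add up to at most [H] times 3/2 of the
    diagonal, hence 3/4 of [K * diag]; half of the remaining quarter gives 1/8. *)
Lemma characteristic_ge {R : realType} {n : nat} (f : 'rV[R]_n -> R)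
    (r C xi : R) (l : nat) (P : seq (cell R n)) (D : cell R n)
    (xs : 'rV[R]_n) :
  lo D != hi D -> in_box (lo D) (hi D) xs ->
  f xs <= f (lo D) -> f xs <= f (hi D) -> 2 * H f xs D <= K r C xi l P D ->
  8^-1 * K r C xi l P D * diag D.1 - f xs <= characteristic f r C xi l P D.
Proof.
move=> Dd xsD flo fhi HK.
(* If [xs] is this corner the left side is 0, so the term omitted from [H] is not missed. *)
have Hlo : f (lo D) - f xs <= H f xs D * enorm (xs - lo D).
  rewrite /H; have [->|xlo] := eqVneq xs (lo D).
    by rewrite !subrr enorm0 mulr0.
  rewrite -ler_pdivrMr ?enorm_gt0 ?subr_eq0 //.
  by case: ifP => // _; rewrite le_max lexx.
have Hhi : f (hi D) - f xs <= H f xs D * enorm (hi D - xs).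
  rewrite /H; have [<-|xhi] := eqVneq (hi D) xs.
    by rewrite !subrr enorm0 mulr0.
  rewrite -ler_pdivrMr ?enorm_gt0 ?subr_eq0 //.
  by case: ifP => // _; rewrite le_max lexx orbT.
have H0 : 0 <= H f xs D.
  have Ha : 0 <= (f (lo D) - f xs) / enorm (xs - lo D).
    by rewrite divr_ge0 ?enorm_ge0 ?subr_ge0.
  have Hb : 0 <= (f (hi D) - f xs) / enorm (hi D - xs).
    by rewrite divr_ge0 ?enorm_ge0 ?subr_ge0.
  by rewrite /H; do 2!case: ifP => // _; rewrite le_max Ha.
have legs : enorm (xs - lo D) + enorm (hi D - xs) <= 3 / 2 * diag D.1.
  by have := enorm_corners_le _ _ _ xsD; rewrite /lo /hi -surjective_pairing.
have /(ler_wpM2l H0) := legs.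
have := ler_wpM2r (enorm_ge0 _ : 0 <= diag D.1) HK.
rewrite /characteristic; nra.
Qed.

(* A trial point equal to [xs] may be listed only once, so the approximating
   trial points must differ from [xs] to occur at infinitely many indices. *)
Lemma subsequential_limit_of_accumulation {R : realType} {n : nat}
    (y : nat -> 'rV[R]_n) (xs : 'rV[R]_n) :
  (forall e : R, 0 < e -> exists k, 0 < enorm (y k - xs) < e) ->
  subsequential_limit y xs.
Proof.
move=> acc.
have late m (e : R) : 0 < e -> exists k, (m <= k)%N /\ 0 < enorm (y k - xs) < e.
  elim: m e => [|m IH] e e0; first by have [k ?] := acc e e0; exists k.
  (* The threshold [d] rules out index [m]: either [y m] is [xs], at distance 0, or its distance is
     at least [d]. *)
  pose d := if y m == xs then e else Num.min e (enorm (y m - xs)).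
  have d0 : 0 < d.
    by rewrite /d; case: eqVneq => // ?; rewrite lt_min e0 enorm_gt0 subr_eq0.
  have [k [mk /andP[k0 kd]]] := IH d d0.
  exists k; split; last first.
    rewrite k0 /=; apply: lt_le_trans kd _.
    by rewrite /d; case: ifP => // _; rewrite ge_min lexx.
  rewrite ltn_neqAle mk andbT; apply/eqP => km; move: k0 kd.
  rewrite -km /d enorm_gt0 subr_eq0 => /negbTE ->.
  by rewrite lt_min ltxx andbF.
(* The pair holds a lower bound for the index and a precision. *)
have /choice[h hP] (p : nat * nat) :
    exists k, (p.1 <= k)%N /\ enorm (y k - xs) < p.2.+1%:R^-1.
  have p0 : 0 < p.2.+1%:R^-1 :> R by rewrite invr_gt0.
  by have [k [? /andP[_ ?]]] := late p.1 _ p0; exists k.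
pose fix s k := if k is j.+1 then h ((s j).+1, j.+1) else h (0, 0)%N.
exists s; split.
  by apply/increasing_seqP => k; rewrite ltEnat /=; have [] := hP ((s k).+1, k.+1).
have sP k : enorm (y (s k) - xs) < k.+1%:R^-1.
  by case: k => [|k]; [have [] := hP (0, 0)%N | have [] := hP ((s k).+1, k.+1)].
apply/cvg_ballP => e e0.
have [k0 _ k0P] := near_infty_natSinv_lt (PosNum e0).
exists k0 => // k /k0P /= ke; split=> // i j.
(* Balls of row vectors are coordinatewise, and [enorm] dominates each coordinate. *)
rewrite (ord1 i) /ball /= distrC.
have := coord_le_enorm (y (s k) - xs) j; rewrite !mxE => yk.
exact: le_lt_trans yk (lt_trans (sP k) ke).
Qed.

Theorem theorem2 (R : realType) (n : nat) (a b : 'rV[R]_n)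
    (f : 'rV[R]_n -> R) (L r C xi : R) (st : strategy)
    (P : nat -> seq (cell R n)) (N : nat -> nat) (y : nat -> 'rV[R]_n)
    (xs : 'rV[R]_n) :
  vle a b -> a <> b ->
  0 < L -> lipschitz_on_box a b f L ->
  1 < r -> 0 < C -> 0 < xi ->
  ndal_run f r C xi st a b P N y ->
  global_minimizer a b f xs ->
  (exists lstar : nat, forall l : nat, (lstar < l)%N ->
     exists D : cell R n,
       [/\ D \in P l, in_box (lo D) (hi D) xs
         & 2 * H f xs D <= K r C xi l (P l) D]) ->
  subsequential_limit y xs.
Proof.
move=> ab /eqP ad L0 fL r1 C0 xi0 run [xsab xsmin] [lstar good].
apply: subsequential_limit_of_accumulation => e e0.
have Pv := ndal_run_valid a b f L r C xi st P N y C0 xi0 ab ad fL run.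
set Kmax := (r + C) * Num.max L xi.
have Kmax0 : 0 < Kmax by rewrite mulr_gt0 ?lt_max ?L0 //; lra.
(* From [xi * diag D.1 / 8 <= Kmax * diag Dt.1 / 2], this threshold for [diag Dt.1] forces
   [diag D.1 < e]. *)
have e'0 : 0 < xi * e / (4 * Kmax) by apply: divr_gt0; exact: mulr_gt0.
have [[|l] [Dt []]] :=
  late_small_split a b f L r C xi st P N y lstar _ C0 xi0 ab ad fL run e'0.
  by [].
move=> ll DtP Dtmax Dte.
have [D [DP xsD HD]] := good _ ll.
have minf D' : D' \in P l.+1 -> f xs <= f (lo D') /\ f xs <= f (hi D').
  move=> /Pv [[? ? ?] _]; split; apply: xsmin; split=> //.
    exact: vle_trans (hi D') _ _ _ _.
  exact: vle_trans (lo D') _ _ _ _.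
have [_ [Dd _ loY hiY]] := Pv _ _ DP.
have [? ?] := minf _ DP; have [? ?] := minf _ DtP.
have De : diag D.1 < e.
  have := characteristic_ge f r C xi l.+1 (P l.+1) D xs Dd xsD
    ltac:(assumption) ltac:(assumption) HD.
  have := Dtmax _ DP.
  have := characteristic_le f r C xi l.+1 (P l.+1) Dt (f xs)
    ltac:(assumption) ltac:(assumption).
  have Kt := K_le a b f L r C xi l.+1 (P l.+1) _ Dt L0 r1 C0 xi0 isT (Pv l) DtP.
  have KD := K_ge r C xi l.+1 (P l.+1) D r1 C0 xi0.
  have := ler_wpM2r (enorm_ge0 _ : 0 <= diag Dt.1) Kt.
  have := ler_wpM2r (enorm_ge0 _ : 0 <= diag D.1) KD.
  move: Dte; rewrite ltr_pdivlMr ?(mulr_gt0 _ Kmax0) // -/Kmax => Dte ? ? ? ? ?.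
  by rewrite -(ltr_pM2l xi0); lra.
(* In each coordinate two points of the box differ by at most its edge. *)
have near v : vle (lo D) v -> vle v (hi D) -> enorm (v - xs) < e.
  move=> lov vhi; apply: le_lt_trans De; apply: le_enorm => i; rewrite !mxE.
  case: xsD => /(_ i) ? /(_ i) ?; have := lov i; have := vhi i.
  rewrite /lo /hi in lov vhi *; nra.
have [v [vY vne ve]] :
    exists v, [/\ v \in mkseq y (N l.+1), v != xs & enorm (v - xs) < e].
  have [_ [xlo xhi]] := (DP, xsD).
  have [lox|?] := eqVneq (lo D) xs; last first.
    by exists (lo D); split=> //; apply: near => // i; apply: le_trans (xhi i).
  exists (hi D); split=> //; first by rewrite eq_sym -lox.
  by apply: near => // i; apply: le_trans (xhi i).
have /mapP[k _ vk] := vY; exists k; by rewrite -vk enorm_gt0 subr_eq0 vne.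
Qed.
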